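(* Consider a bandit with $K$ arms, rewards in $[0,1]$, $B$ blocks of lengths $H_b$, $T=\sum_bH_b$, a collection $\mathcal G$ of groups such that every arm lies in at most $t\ge1$ groups, and group floors $(f_g)_{g\in\mathcal G}$ to be met in every block. In each block $b$, let $x_b\in\mathbb R_{\ge0}^K$ be any group-feasible fractional plan with slack $t$, i.e. $\sum_{i\in g}x_{b,i}\ge f_g+t$ for every $g\in\mathcal G$, whose ceiling budget satisfies $\sum_i\lceil x_{b,i}\rceil\le H_b$; let $n_b$ be its Beck--Fiala rounding; execute the $n_{b,i}$ mandatory pulls of each arm $i$; and run UCB on the remaining $R_b=H_b-\sum_in_{b,i}$ rounds of the block (Group-BDQ-UCB). Then every group floor is met in every block deterministically, and with probability at least $1-\eta$ the fair regret relative to the comparator that executes the same mandatory allocations $(n_b)_{b\le B}$ and assigns every residual round to a best arm is at most $K+4\sqrt{2KRL}$, with $R=\sum_bR_b$ and $L=\log(2KT/\eta)$.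
   Context: Bandit: arm $i\in[K]$ produces independent rewards in $[0,1]$ with mean $\mu_i$ (i.i.d. within an arm); $\mu_\star=\max_i\mu_i$; $A_\tau$ is the arm pulled at round $\tau$; $\eta\in(0,1)$. Group floor in block $b$: $\sum_{i\in g}N_{b,i}\ge f_g$, where $N_{b,i}$ is the number of pulls of arm $i$ inside block $b$. Fair regret relative to the comparator: $\sum_b\bigl(\sum_in_{b,i}\mu_i+R_b\mu_\star\bigr)-\sum_{\tau=1}^T\mu_{A_\tau}$. UCB rule in residual rounds: pull an arm maximizing $U_i$, where $U_i=+\infty$ if arm $i$ has no observations and $U_i=\widehat\mu_i+\sqrt{2L/N_i}$ otherwise, with $N_i,\widehat\mu_i$ the pull count and empirical mean of arm $i$ over all observations so far (mandatory and residual, all blocks). Beck--Fiala rounding of $x$: write $x_i=\lfloor x_i\rfloor+\phi_i$, start from $y=\phi$; a coordinate is alive if $y_i\in(0,1)$, frozen otherwise; a group is active if it has more than $t$ alive coordinates. While some coordinate is alive, choose a nonzero $v$ supported on alive coordinates with $\sum_{i\in g}v_i=0$ for all active $g$, move $y$ along $\pm v$ until some alive coordinate hits $0$ or $1$, and freeze it. Output $n_i=\lfloor x_i\rfloor+y_i$. The plans $x_b$ do not depend on the observed rewards. *)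

(* Defs.v *)
From mathcomp Require Import all_boot all_order all_algebra.
From mathcomp Require Import all_classical all_reals all_analysis.

Set Implicit Arguments.
Unset Strict Implicit.
Unset Printing Implicit Defensive.
Import Order.TTheory GRing.Theory Num.Theory.
Local Open Scope classical_set_scope.
Local Open Scope ring_scope.

(** ** Beck-Fiala rounding *)

Section BeckFiala.
Variables (R : realType) (K t : nat) (G : {set {set 'I_K}}).
Implicit Types (x y v : 'rV[R]_K) (i : 'I_K) (g : {set 'I_K}).

Definition alive y : {set 'I_K} := [set i | 0 < y 0 i < 1]%SET.

Definition active y g : bool := (g \in G) && (t < #|g :&: alive y|)%N.

Definition frac_row x : 'rV[R]_K := \row_i (x 0 i - (Num.floor (x 0 i))%:~R).

(* The real s carries both the sign of the direction and the length of the
   move. By convexity of [0, 1], the last two clauses say that y + s *: v is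
   the first point of the move at which an alive coordinate reaches 0 or 1. *)
Definition bf_step y y' : Prop :=
  exists v (s : R),
    [/\ v != 0,
        forall i, i \notin alive y -> v 0 i = 0,
        forall g, active y g -> \sum_(i in g) v 0 i = 0,
        y' = y + s *: v
      & (forall i, 0 <= y' 0 i <= 1)
        /\ exists2 i, i \in alive y & (y' 0 i == 0) || (y' 0 i == 1)].

Inductive bf_reachable x : 'rV[R]_K -> Prop :=
| BFStart : bf_reachable x (frac_row x)
| BFMove y y' : bf_reachable x y -> bf_step y y' -> bf_reachable x y'.

(* A relation, since the direction and the sign of every move are free. *)
Definition beck_fiala_rounding x (n : 'I_K -> nat) : Prop :=
  exists y,
    [/\ bf_reachable x y, alive y = finset.set0
      & forall i, (n i)%:R = (Num.floor (x 0 i))%:~R + y 0 i].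

End BeckFiala.

(** ** Rewards *)

Section Rewards.
Context (d : measure_display) (Omega : measurableType d) (R : realType).
Variable P : probability Omega R.

Definition mutually_independent (I : choiceType) (X : I -> {RV P >-> R}) : Prop :=
  forall (s : seq I) (E : I -> set R), uniq s -> (forall i, measurable (E i)) ->
    P (\bigcap_(i in [set` s]) (X i @^-1` E i)) =
    (\prod_(i <- s) P (X i @^-1` E i))%E.

(* X i s is the reward returned by the (s+1)-st pull of arm i. *)
Record bandit_rewards (K : nat) (mu : 'I_K -> R)
    (X : 'I_K -> nat -> {RV P >-> R}) : Prop := {
  rewards_bounded : forall i s w, 0 <= X i s w <= 1;
  rewards_mean : forall i s, ('E_P[X i s] = (mu i)%:E)%E;
  rewards_id : forall i s (E : set R), measurable E ->
    distribution P (X i s) E = distribution P (X i 0%N) E;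
  rewards_indep :
    mutually_independent (fun p : 'I_K * nat => X p.1 p.2) }.

End Rewards.

(** ** The algorithm and its regret *)

Section Algorithm.
Variables (R : realType) (K B : nat) (H : 'I_B -> nat).
(* a : sequence of pulled arms (rounds are numbered from 0),
   X : realized rewards, indexed by arm and number of earlier pulls,
   n : mandatory allocation of every block. *)
Implicit Types (a : nat -> 'I_K) (X : 'I_K -> nat -> R)
  (n : 'I_B -> 'I_K -> nat) (mu : 'I_K -> R) (i : 'I_K) (b : 'I_B).

Definition horizon : nat := \sum_b H b.

(* Block b consists of the rounds block_start b, ..., block_end b - 1. *)
Definition block_start b : nat := \sum_(c < B | (c < b)%N) H c.
Definition block_end b : nat := block_start b + H b.

Definition pulls a i (r r' : nat) : nat :=
  count (fun tau => a tau == i) (index_iota r r').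

Definition block_pulls a b i : nat := pulls a i (block_start b) (block_end b).

Definition reward X a (tau : nat) : R := X (a tau) (pulls a (a tau) 0 tau).

Definition empirical_mean X a i (tau : nat) : R :=
  (\sum_(0 <= s < tau | a s == i) reward X a s) / (pulls a i 0 tau)%:R.

(* Index of arm i at round tau, computed from the rounds before tau. *)
Definition ucb_index (L : R) X a i (tau : nat) : \bar R :=
  if pulls a i 0 tau == 0%N then +oo%E
  else (empirical_mean X a i tau + Num.sqrt (2 * L / (pulls a i 0 tau)%:R))%:E.

Definition mandatory_end n b : nat := block_start b + \sum_i n b i.

(* The mandatory pulls come first, in any order; ties in the maximization of
   the index are broken arbitrarily. *)
Record group_bdq_ucb (L : R) n X a : Prop := {
  mandatory_rounds :
    forall b i, pulls a i (block_start b) (mandatory_end n b) = n b i;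
  residual_rounds :
    forall b tau, (mandatory_end n b <= tau < block_end b)%N ->
    forall j, (ucb_index L X a j tau <= ucb_index L X a (a tau) tau)%E }.

(* The subtraction is truncated, but mandatory pulls never exceed the length of
   the block when n b is a rounding of a plan whose ceilings sum to at most
   H b. *)
Definition residual n b : nat := H b - \sum_i n b i.

(* The default 0 of the maximum is harmless: rewards, hence means, are
   nonnegative. *)
Definition best_mean mu : R := \big[Num.max/0]_i mu i.

Definition fair_regret mu n a : R :=
  \sum_b (\sum_i (n b i)%:R * mu i + (residual n b)%:R * best_mean mu)
  - \sum_(0 <= tau < horizon) mu (a tau).

End Algorithm.

(* Main.v *)
Require Import Defs.
From mathcomp Require Import all_boot all_order all_algebra.
From mathcomp Require Import all_classical all_reals all_analysis.
From mathcomp Require Import measurable_realfun.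
From mathcomp Require Import zify ring lra.

Set Implicit Arguments.
Unset Strict Implicit.
Unset Printing Implicit Defensive.
Import Order.TTheory GRing.Theory Num.Theory.
Local Open Scope classical_set_scope.
Local Open Scope ring_scope.

(* A group that is active keeps its total mass under every rounding move, and
   after it stops being active it can lose at most t, which is the slack of the
   plan; no coordinate leaves the unit interval above its floor and integral ones never
   move, so the ceiling budget bounds the mandatory pulls.

   The regret is the sum over residual rounds of the gap between the best mean
   and the mean of the pulled arm. When every empirical mean after N pulls lies
   within sqrt (2L / N) of its mean, a UCB pull has gap at most 2 sqrt (2L / N);
   summing 1 / sqrt N along each arm and applying Cauchy-Schwarz over the arms
   gives 4 sqrt (2KRL), and the first pull of each arm costs at most 1. The
   concentration event fails with probability at most 2KT exp (- L) = eta, by a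
   Chernoff bound and a union bound over the arms and the numbers of pulls. *)

(** * Beck-Fiala rounding: loss of a group and ceiling bound *)

Section BeckFialaRounding.
Variables (R : realType) (K t : nat) (G : {set {set 'I_K}}).
Implicit Types (x y : 'rV[R]_K) (i : 'I_K) (g : {set 'I_K}).

Lemma bf_step_frozen y y' i : bf_step t G y y' -> i \notin alive y -> y' 0 i = y 0 i.
Proof.
by case=> v [s [_ vi0 _ -> _]] yi; rewrite !mxE vi0// mulr0 addr0.
Qed.

Lemma bf_step_alive y y' : bf_step t G y y' -> alive y' \subset alive y.
Proof.
move=> st; apply/fintype.subsetP => i; apply: contraLR => iy; move: (iy).
by rewrite !inE (bf_step_frozen st).
Qed.

Lemma bf_step_active y y' g : bf_step t G y y' -> active t G y' g -> active t G y g.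
Proof.
move=> /bf_step_alive sub /andP[gG lt]; rewrite /active gG /=.
exact: leq_trans lt (subset_leq_card (finset.setIS _ sub)).
Qed.

Lemma bf_step_sum y y' g : bf_step t G y y' -> active t G y g ->
  \sum_(i in g) y' 0 i = \sum_(i in g) y 0 i.
Proof.
case=> v [s [_ _ v0 -> _]] /v0 vg.
rewrite (eq_bigr (fun i => y 0 i + s * v 0 i)); last by move=> i _; rewrite !mxE.
by rewrite big_split /= -mulr_sumr vg mulr0 addr0.
Qed.

Lemma frac_row_itv x i : 0 <= frac_row x 0 i < 1.
Proof.
rewrite mxE subr_ge0 ltrBlDl floor_le /=.
by have := floorD1_gt (x 0 i); rewrite intrD.
Qed.

Lemma bf_reachable_itv x y i : bf_reachable t G x y -> 0 <= y 0 i <= 1.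
Proof.
case=> [|y1 y2 _ [v [s [_ _ _ _ [H _]]]]]; last exact: H.
by case/andP: (frac_row_itv x i) => -> /ltW.
Qed.

Lemma bf_reachable_eq0 x y i : bf_reachable t G x y -> frac_row x 0 i = 0 -> y 0 i = 0.
Proof.
move=> + x0; elim=> // y1 y2 _ IH st.
by rewrite (bf_step_frozen st)// inE IH ltxx.
Qed.

(** Activity is inherited backwards, because alive sets only shrink; a group active now was
    therefore conserved by every earlier move. *)
Lemma bf_reachable_active x y g : bf_reachable t G x y -> active t G y g ->
  \sum_(i in g) y 0 i = \sum_(i in g) frac_row x 0 i.
Proof.
elim=> // y1 y2 _ IH st ag.
have ag1 := bf_step_active st ag.
by rewrite (bf_step_sum st ag1) IH.
Qed.

(* Once a group stops being active, only its at most t alive coordinates can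
   still decrease, each by less than 1, so its frozen mass is already within t
   of the initial mass; frozen mass can only grow afterwards. *)
Lemma bf_reachable_inactive x y g : bf_reachable t G x y -> g \in G ->
  ~~ active t G y g ->
  \sum_(i in g) frac_row x 0 i <= \sum_(i in g | i \notin alive y) y 0 i + t%:R.
Proof.
move=> ry gG.
have base (z : 'rV[R]_K) : (forall i, 0 <= z 0 i <= 1) -> ~~ active t G z g ->
    \sum_(i in g) z 0 i <= \sum_(i in g | i \notin alive z) z 0 i + t%:R.
  move=> zb; rewrite /active gG /= -leqNgt => ct.
  rewrite (bigID (mem (alive z))) /= addrC lerD2l.
  apply: (@le_trans _ _ (\sum_(i in g | i \in alive z) 1)).
    by apply: ler_sum => i _; case/andP: (zb i).
  rewrite sumr_const ler_nat (leq_trans _ ct)//.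
  by apply/subset_leq_card/fintype.subsetP => i; rewrite finset.in_setI.
elim: ry => [|y1 y2 r1 IH st] na.
  by apply: base => // i; case/andP: (frac_row_itv x i) => -> /ltW.
have r2 := BFMove r1 st.
(* If this very move deactivates the group, its direction was still balanced on the group, so the
   total mass after the move is the initial one and [base] applies. *)
have [a1|n1] := boolP (active t G y1 g).
  rewrite -(bf_reachable_active r1 a1) -(bf_step_sum st a1).
  by apply: base => // i; exact: bf_reachable_itv r2.
apply: le_trans (IH n1) _; rewrite lerD2r.
have sub := fintype.subsetP (bf_step_alive st).
rewrite [leRHS](bigID (mem (alive y1))) /= -[leLHS]add0r lerD//.
  by apply: sumr_ge0 => i _; case/andP: (bf_reachable_itv i r2).
rewrite [leRHS](eq_bigl [pred i | (i \in g) && (i \notin alive y1)]); last first.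
  move=> i; rewrite /= -andbA; congr andb.
  by apply/andP/idP => [[]//|ni]; split=> //; apply: contra ni; exact: sub.
by apply: ler_sum => i /andP[_ ni]; rewrite (bf_step_frozen st).
Qed.

(** Each final [y 0 i] is 0 or 1. A final 1 needs a nonzero fractional part, as integral coordinates
    stay at 0, and then the ceiling is at least the floor plus 1. *)
Lemma beck_fiala_le_ceil x n i :
  beck_fiala_rounding t G x n -> (n i)%:Z <= Num.ceil (x 0 i).
Proof.
case=> y [ry ay ny].
have yi : y 0 i = 0 \/ y 0 i = 1.
  have : i \notin alive y by rewrite ay inE.
  rewrite inE; case/andP: (bf_reachable_itv i ry) => y0 y1.
  rewrite !lt_neqAle y0 y1 !andbT negb_and !negbK => /orP[]/eqP ->; auto.
rewrite -(ler_int R) -pmulrn ny.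
have [x0|x0] := eqVneq (frac_row x 0 i) 0.
  rewrite (bf_reachable_eq0 ry x0) addr0.
  exact: le_trans (floor_le _) (ceil_ge _).
have lt : (Num.floor (x 0 i))%:~R < x 0 i.
  by rewrite lt_neqAle floor_le andbT; apply: contra x0; rewrite mxE subr_eq0 eq_sym.
have : Num.floor (x 0 i) + 1 <= Num.ceil (x 0 i).
  by rewrite lezD1 -(ltr_int R); exact: lt_le_trans lt (ceil_ge _).
rewrite -(ler_int R) intrD; apply: le_trans; rewrite lerD2l.
by case/andP: (bf_reachable_itv i ry).
Qed.

(** At the end no coordinate is alive, so the group is inactive and all of its mass is frozen. *)
Lemma beck_fiala_group x n g : beck_fiala_rounding t G x n -> g \in G ->
  \sum_(i in g) x 0 i <= \sum_(i in g) (n i)%:R + t%:R.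
Proof.
case=> y [ry ay ny] gG.
have na : ~~ active t G y g by rewrite /active ay finset.setI0 cards0 ltn0 andbF.
have := bf_reachable_inactive ry gG na.
rewrite ay; have -> : \sum_(i in g | i \notin finset.set0) y 0 i = \sum_(i in g) y 0 i.
  by apply: eq_bigl => i; rewrite finset.in_set0 andbT.
rewrite (eq_bigr (fun i => x 0 i - (Num.floor (x 0 i))%:~R)); last by move=> i _; rewrite mxE.
rewrite sumrB lerBlDl addrA -big_split /= => /le_trans; apply.
by rewrite lerD2r; apply: ler_sum => i _; rewrite ny.
Qed.

Lemma beck_fiala_budget x n (h : nat) : beck_fiala_rounding t G x n ->
  \sum_i Num.ceil (x 0 i) <= h%:Z -> (\sum_i n i <= h)%N.
Proof.
move=> bf; rewrite -lez_nat; apply: le_trans.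
by rewrite (raddf_sum (Posz)) /=; apply: ler_sum => i _; exact: beck_fiala_le_ceil bf.
Qed.

End BeckFialaRounding.

(** * Product formula for expectations of independent variables *)

Section Independence.
Context (d : measure_display) (Omega : measurableType d) (R : realType).
Variable P : probability Omega R.

Import HBNNSimple.

(* Both sides are measures in the set E of the hypothesis, so agreement on
   indicators extends to nonnegative functions by simple approximation. *)
Lemma ge0_integralM_factor (W : Omega -> R) (Y : Omega -> R) (f : R -> R) :
  measurable_fun setT Y ->
  measurable_fun setT W -> (forall w, 0 <= W w) ->
  (\int[P]_w (W w)%:E < +oo)%E ->
  measurable_fun setT f -> (forall r, 0 <= f r) ->
  (forall E, measurable E ->
     \int[P]_w (W w * \1_E (Y w))%:E =
     \int[P]_w (\1_E (Y w))%:E * \int[P]_w (W w)%:E)%E ->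
  (\int[P]_w (W w * f (Y w))%:E =
   \int[P]_w (f (Y w))%:E * \int[P]_w (W w)%:E)%E.
Proof.
move=> mY mW W0 Wfin mf f0 HE.
have mEf : measurable_fun [set: R] (fun r : R => (f r)%:E) by exact/measurable_EFinP.
pose f_ := nnsfun_approx measurableT mEf.
have mfY n : measurable_fun setT (fun w => f_ n (Y w)).
  exact: (measurableT_comp (measurable_funP (f_ n)) mY).
have cf w : ((f_ n (Y w))%:E @[n --> \oo] --> (f (Y w))%:E)%classic.
  by apply: (@cvg_nnsfun_approx _ _ _ _ measurableT _ mEf) => // x _; rewrite lee_fin.
have nd w : {homo (fun n => f_ n (Y w)) : n m / (n <= m)%N >-> n <= m}.
  by move=> m n mn; exact/lefP/nd_nnsfun_approx.
have simple n : (\int[P]_w (W w * f_ n (Y w))%:E =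
   \int[P]_w (f_ n (Y w))%:E * \int[P]_w (W w)%:E)%E.
  have mE r : measurable (f_ n @^-1` [set r]).
    by rewrite -[X in measurable X]setTI; apply: (measurable_funP (f_ n)).
  have m1 r : measurable_fun setT (fun w => \1_(f_ n @^-1` [set r]) (Y w) : R).
    by apply: measurableT_comp mY; exact: measurable_indic.
  have ge r w : (0 <= (r * \1_(f_ n @^-1` [set r]) (Y w))%:E)%E.
    by rewrite EFinM nnfun_muleindic_ge0.
  transitivity (\sum_(r \in range (f_ n)) \int[P]_w
      (W w * (r * \1_(f_ n @^-1` [set r]) (Y w)))%:E)%E.
    rewrite -ge0_integral_fsum//; last 2 first.
    - move=> r; apply/measurable_EFinP/measurable_funM => //.
      exact: measurable_funM.
    - by move=> r w _; rewrite EFinM mule_ge0// lee_fin.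
    apply: eq_integral => w _; rewrite EFinM fimfunE -fsumEFin//.
    by rewrite ge0_mule_fsumr//; apply: eq_fsbigr => r _.
  transitivity (\sum_(r \in range (f_ n)) (\int[P]_w
      (r * \1_(f_ n @^-1` [set r]) (Y w))%:E * \int[P]_w (W w)%:E))%E.
    apply: eq_fsbigr => r; rewrite inE => -[z _ zr].
    have r0 : 0 <= r by rewrite -zr.
    under eq_integral do rewrite mulrCA EFinM.
    under [in RHS]eq_integral do rewrite EFinM.
    rewrite !ge0_integralZl//; last 3 first.
    - exact/measurable_EFinP.
    - by apply/measurable_EFinP; apply: measurable_funM.
    - by move=> w _; rewrite lee_fin mulr_ge0.
    by rewrite HE// muleA.
  rewrite [RHS]muleC.
  have -> : (\int[P]_w (f_ n (Y w))%:E =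
      \int[P]_w \sum_(r \in range (f_ n)) (r * \1_(f_ n @^-1` [set r]) (Y w))%:E)%E.
    by apply: eq_integral => w _; rewrite fimfunE -fsumEFin.
  rewrite ge0_integral_fsum//; last by move=> r; apply/measurable_EFinP/measurable_funM.
  rewrite ge0_mule_fsumr; last by move=> r; apply: integral_ge0.
  by apply: eq_fsbigr => r _; rewrite muleC.
have Wge0 : (0 <= \int[P]_w (W w)%:E)%E.
  by apply: integral_ge0 => w _; rewrite lee_fin.
transitivity (limn (fun n => \int[P]_w (W w * f_ n (Y w))%:E)%E).
  rewrite -monotone_convergence//.
  - apply: eq_integral => w _; apply/esym/cvg_lim => //.
    under eq_fun do rewrite EFinM.
    by rewrite EFinM; apply: cvgeZl => //; exact: cf.
  - by move=> n; apply/measurable_EFinP/measurable_funM.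
  - by move=> n w _; rewrite lee_fin mulr_ge0.
  - by move=> w _ m n mn; rewrite lee_fin ler_wpM2l// nd.
under eq_fun do rewrite simple.
(* Finiteness of the integral of [W] lets this factor leave the limit. *)
rewrite limeMr//; last 2 first.
- by rewrite ge0_fin_numE.
- apply/ereal_nondecreasing_is_cvgn => a b ab; apply: ge0_le_integral => //.
  + by move=> w _; rewrite lee_fin.
  + exact/measurable_EFinP.
  + exact/measurable_EFinP.
  + by move=> w _; rewrite lee_fin; exact: nd.
congr (_ * _)%E; rewrite -monotone_convergence//.
- by apply: eq_integral => w _; apply/cvg_lim => //; exact: cf.
- by move=> n; apply/measurable_EFinP.
- by move=> n w _; rewrite lee_fin.
- by move=> w _ m n mn; rewrite lee_fin nd.
Qed.

(** The hypothesis speaks of events, that is of indicators; these are exchanged for the functions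
    [f i] one variable at a time. *)
Lemma integral_prod_independent (I : choiceType) (X : I -> {RV P >-> R})
    (f : I -> R -> R) (s : seq I) :
  mutually_independent X -> uniq s ->
  (forall i, measurable_fun setT (f i)) -> (forall i r, 0 <= f i r) ->
  (forall i, \int[P]_w (f i (X i w))%:E < +oo)%E ->
  (\int[P]_w (\prod_(i <- s) f i (X i w))%:E =
   \prod_(i <- s) \int[P]_w (f i (X i w))%:E)%E.
Proof.
move=> indep us mf f0 ffin.
have mXE E i : measurable E -> measurable (X i @^-1` E).
  by move=> mE; rewrite -[Y in measurable Y]setTI; exact: measurable_funP.
have indicE_int E i : measurable E ->
    (\int[P]_w (\1_E (X i w))%:E = P (X i @^-1` E))%E.
  move=> mE; rewrite -[X i @^-1` E]setIT -integral_indic//; exact: mXE.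
(* Induction on the variables [s1] that carry general functions, while those in [s2] still carry
   indicators. *)
suff H s1 : forall s2 g E, uniq (s1 ++ s2) -> (forall i, measurable_fun setT (g i)) ->
    (forall i (r : R), 0 <= g i r :> R) ->
    (forall i, \int[P]_w (g i (X i w))%:E < +oo)%E ->
    (forall i, measurable (E i)) -> (forall i, i \in s2 -> g i = \1_(E i)) ->
    (\int[P]_w (\prod_(i <- s1 ++ s2) g i (X i w))%:E =
     \prod_(i <- s1 ++ s2) \int[P]_w (g i (X i w))%:E)%E.
  have := H s [::] f (fun _ => setT); rewrite cats0; exact.
elim: s1 => [|i s1 IH] s2 g E /=.
  move=> us2 mg g0 gfin mE gE.
  (* With indicators only, the integrand is the indicator of an intersection and the claim is
     independence itself. *)
  rewrite [RHS](eq_big_seq (fun i => P (X i @^-1` E i))); last first.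
    by move=> i /gE ->; exact: indicE_int.
  rewrite -indep// -[X in _ = P X]setIT -integral_indic//; last first.
    apply: fin_bigcap_measurable => // i _; exact: mXE.
  apply: eq_integral => w _; congr EFin.
  rewrite (eq_big_seq (fun i => \1_(E i) (X i w))); last by move=> i /gE ->.
  rewrite indicE; have [h|h] := boolP (w \in _).
    rewrite big1_seq// => i /andP[_ is2]; rewrite indicE mem_set//.
    exact: (set_mem h).
  have [i [is2 nE]] : exists i, i \in s2 /\ ~ E i (X i w).
    by move: h; rewrite notin_setE => /existsNP[i /not_implyP[? ?]]; exists i.
  apply/eqP; rewrite prodf_seq_eq0; apply/hasP; exists i => //=.
  by rewrite indicE memNset.
case/andP=> nis us2 mg g0 gfin mE gE.
have mgX j : measurable_fun setT (fun w => g j (X j w)).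
  exact: (measurableT_comp (mg j) (measurable_funP (X j))).
rewrite big_cons.
rewrite -(IH s2 g E)//.
under eq_integral => w _ do rewrite big_cons mulrC.
apply: ge0_integralM_factor => //.
- by apply: measurable_prod => j _.
- by move=> w; apply: prodr_ge0.
- rewrite (IH s2 g E)// ltey_eq; apply/orP; left.
  apply: (big_ind (fun x : \bar R => x \is a fin_num)) => //; first by move=> ? ?; exact: fin_numM.
  move=> j _; rewrite ge0_fin_numE//.
  by apply: integral_ge0 => w _; rewrite lee_fin.
move=> F mF.
(* Putting the indicator of [F] at [i] moves [i] from the general part to the indicator part, where
   the induction hypothesis applies. *)
pose g' := [eta g with i |-> \1_F]; pose E' := [eta E with i |-> F].
have gE' j : j \in s1 ++ s2 -> g' j = g j.
  by move=> js /=; case: eqP => // ji; rewrite -ji js in nis.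
have pe : perm_eq (s1 ++ i :: s2) (i :: s1 ++ s2) by apply/permPl; exact: (perm_catCA s1 [:: i] s2).
have e1 w : \prod_(j <- s1 ++ i :: s2) g' j (X j w) =
    (\prod_(j <- s1 ++ s2) g j (X j w)) * \1_F (X i w).
  rewrite (perm_big _ pe) big_cons /g' /= eqxx mulrC; congr (_ * _).
  by apply: eq_big_seq => j /gE'; rewrite /g' /= => ->.
have e2 : (\prod_(j <- s1 ++ i :: s2) \int[P]_w (g' j (X j w))%:E =
    \int[P]_w (\1_F (X i w))%:E * \prod_(j <- s1 ++ s2) \int[P]_w (g j (X j w))%:E)%E.
  rewrite (perm_big _ pe) big_cons /g' /= eqxx; congr (_ * _)%E.
  by apply: eq_big_seq => j /gE'; rewrite /g' /= => ->.
rewrite (IH s2 g E)// -e2 -(IH (i :: s2) g' E').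
- by apply: eq_integral => w _; rewrite e1.
- by rewrite (perm_uniq pe) /= nis.
- by move=> j; rewrite /g' /=; case: eqP => // _; exact: measurable_indic.
- by move=> j r; rewrite /g' /=; case: eqP.
- move=> j; rewrite /g' /=; case: eqP => // _.
  by rewrite indicE_int// (le_lt_trans (probability_le1 _ _)) ?ltry//; exact: mXE.
- by move=> j; rewrite /E' /=; case: eqP.
- move=> j; rewrite inE /g' /E' /=; case: eqP => //= _; exact: gE.
Qed.

End Independence.

(** * Exponential moments and the Chernoff bound *)

Section Concentration.
Context (R : realType).

(** Squaring [1 - y / 2 <= expR (- (y / 2))] bounds e^(-y) below by (1 - y/2)^2, so it is enough
    that the claimed bound times this square is at least 1. *)
Lemma expR_le_1D2 (y : R) : y <= 1 -> expR y <= 1 + y + 2 * y ^+ 2.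
Proof.
move=> y1.
have h : 1 - y / 2 <= expR (- (y / 2)) by apply: expR_ge1Dx.
have e0 := expR_gt0 (- (y / 2)).
have : expR y * expR (- (y / 2)) ^+ 2 = 1.
  by rewrite -expRM_natl -expRD -[RHS]expR0; congr expR; field.
set a := expR y; set b := expR _ => ab.
have a0 : 0 < a by exact: expR_gt0.
have p0 : 0 <= 1 + y + 2 * y ^+ 2 by nra.
have hb : (1 - y / 2) ^+ 2 <= b ^+ 2.
  by rewrite lerXn2r// nnegrE; [lra|exact: ltW].
have key : 1 <= (1 + y + 2 * y ^+ 2) * (1 - y / 2) ^+ 2.
  have -> : (1 + y + 2 * y ^+ 2) * (1 - y / 2) ^+ 2 =
    1 + y ^+ 2 * ((1 - y) * (5 / 4 - y / 2)) by field.
  by rewrite lerDl mulr_ge0 ?sqr_ge0// mulr_ge0//; lra.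
have : 1 <= (1 + y + 2 * y ^+ 2) * b ^+ 2.
  by apply: le_trans key _; rewrite ler_wpM2l.
rewrite -ab => h2.
by rewrite -(ler_pM2r (exprn_gt0 2 e0)).
Qed.

Context (d : measure_display) (Omega : measurableType d).
Variable P : probability Omega R.

Lemma expectation_itv (Y : {RV P >-> R}) (m : R) :
  (forall w, 0 <= Y w <= 1) -> ('E_P[Y] = m%:E)%E -> 0 <= m <= 1.
Proof.
move=> Y01 EY; rewrite -!lee_fin -EY; apply/andP; split.
  by apply: expectation_ge0 => w; case/andP: (Y01 w).
rewrite -(expectation_cst P 1); apply: expectation_le => //.
- by move=> w; case/andP: (Y01 w).
- by apply: aeW => w; case/andP: (Y01 w).
Qed.

(* e^u <= 1 + u + 2u^2 and Y^2 <= Y bound the integrand by an affine function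
   of Y, so that only the mean of Y matters. *)
Lemma centered_mgf_le (Y : {RV P >-> R}) (m l : R) :
  (forall w, 0 <= Y w <= 1) -> ('E_P[Y] = m%:E)%E -> `|l| <= 1 ->
  (\int[P]_w (expR (l * (Y w - m)))%:E <= (expR (l ^+ 2 / 2))%:E)%E.
Proof.
move=> Y01 EY l1; have /andP[m0 m1] := expectation_itv Y01 EY.
(* Coefficients of the quadratic bound in [l * (Y w - m)] after [Y w ^+ 2] is replaced by [Y w]. *)
pose c1 := l + 2 * l ^+ 2 * (1 - 2 * m).
pose c0 := 1 - l * m + 2 * l ^+ 2 * m ^+ 2.
have bd w : expR (l * (Y w - m)) <= c1 * Y w + c0.
  have /andP[y0 y1] := Y01 w.
  apply: (le_trans (expR_le_1D2 _)).
    apply: le_trans (ler_norm _) _; rewrite normrM mulr_ile1//.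
    by rewrite ler_norml; apply/andP; split; lra.
  have yy : Y w ^+ 2 <= Y w by rewrite expr2 ler_piMr.
  have : 2 * l ^+ 2 * Y w ^+ 2 <= 2 * l ^+ 2 * Y w.
    by rewrite ler_wpM2l// mulr_ge0 ?sqr_ge0.
  by rewrite /c1 /c0; move: (Y w) => y; nra.
have mY : measurable_fun setT (Y : Omega -> R) by exact: measurable_funP.
have Y1 : (Y : Omega -> R) \in Lfun P 1.
  rewrite Lfun1_integrable; apply: (@le_integrable _ _ _ P _ measurableT _ (cst 1%:E)).
  - exact/measurable_EFinP.
  - move=> w _ /=; rewrite normr1 lee_fin; case/andP: (Y01 w) => y0 y1.
    by rewrite ger0_norm.
  - exact: finite_measure_integrable_cst.
have mE : measurable_fun setT (fun w => expR (l * (Y w - m))).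
  apply: measurableT_comp => //; apply: measurable_funM => //.
  exact: measurable_funB.
apply: (@le_trans _ _ ('E_P[(fun w => c1 * Y w + c0)%R])%E).
  rewrite unlock; apply: ge0_le_integral => //.
  - exact/measurable_EFinP.
  - by apply/measurable_EFinP/measurable_funD => //; exact: measurable_funM.
  - by move=> w _; rewrite lee_fin.
have -> : (fun w => c1 * Y w + c0) = (c1 \o* (Y : Omega -> R)) \+ cst c0.
  by apply/funext => w /=; rewrite mulrC.
rewrite expectationD ?Lfun_cst//; last exact: Lfun_scale.
rewrite expectationZl// expectation_cst EY -EFinM -EFinD lee_fin.
(* At the mean the affine bound equals 1 + 2 l^2 m (1 - m), at most 1 + l^2 / 2 since m (1 - m) <=
   1/4. *)
apply: le_trans (expR_ge1Dx _); rewrite /c1 /c0.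
have : 0 <= l ^+ 2 * (m - 1 / 2) ^+ 2 by rewrite mulr_ge0 ?sqr_ge0.
lra.
Qed.

(* l is at once the Chernoff parameter and, up to its sign, the deviation of the
   empirical mean. *)
Lemma hoeffding_tail (I : choiceType) (X : I -> {RV P >-> R}) (s : seq I) (m : I -> R) (l : R) :
  mutually_independent X -> uniq s ->
  (forall i w, 0 <= X i w <= 1) -> (forall i, ('E_P[X i] = (m i)%:E)%E) ->
  `|l| <= 1 ->
  (P [set w | (l ^+ 2 * (size s)%:R <= l * \sum_(i <- s) (X i w - m i))%R] <=
   (expR (- (l ^+ 2 * (size s)%:R / 2)))%:E)%E.
Proof.
move=> indep us X01 EX l1; set N := size s.
pose f i r := expR (l * (r - m i)).
have mf i : measurable_fun setT (f i).
  by apply: measurableT_comp => //; apply: measurable_funM => //; exact: measurable_funB.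
have mX i : measurable_fun setT (X i : Omega -> R) by exact: measurable_funP.
have ifle i := centered_mgf_le (X01 i) (EX i) l1.
pose Z w := \prod_(i <- s) f i (X i w).
have mZ : measurable_fun setT Z.
  by apply: measurable_prod => i _; exact: measurableT_comp (mf i) (mX i).
have ZE w : Z w = expR (l * \sum_(i <- s) (X i w - m i)).
  by rewrite mulr_sumr expR_sum.
have -> : [set w | l ^+ 2 * N%:R <= l * \sum_(i <- s) (X i w - m i)] =
    [set w | expR (l ^+ 2 * N%:R) <= Z w].
  by apply/seteqP; split=> w /=; rewrite ZE ler_expR.
have intZ : (\int[P]_w (Z w)%:E <= (expR (l ^+ 2 * N%:R / 2))%:E)%E.
  rewrite (integral_prod_independent indep us mf)//; last 2 first.
  - by move=> i r; exact: expR_ge0.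
  - by move=> i; apply: le_lt_trans (ifle i) _; exact: ltry.
  rewrite (_ : expR (l ^+ 2 * N%:R / 2) = \prod_(i <- s) expR (l ^+ 2 / 2)); last first.
    by rewrite big_const_seq count_predT iter_mulr_1 -expRM_natl; congr expR; ring.
  rewrite -prodEFin; elim: s {us N mZ Z ZE} => [|i s IH]; first by rewrite !big_nil.
  rewrite !big_cons; apply: lee_pmul => //.
  - by apply: integral_ge0 => w _; rewrite lee_fin expR_ge0.
  - by apply: prode_ge0 => j _; apply: integral_ge0 => w _; rewrite lee_fin expR_ge0.
  - exact: ifle.
have e0 : 0 < expR (l ^+ 2 * N%:R) by exact: expR_gt0.
(* Markov's inequality at level e^(l^2 N), against a mean of at most e^(l^2 N / 2). *)
have := @le_integral_abse _ _ _ P _ measurableT (EFin \o Z) _ _ e0.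
rewrite setTI => /(_ ltac:(exact/measurable_EFinP)).
have -> : [set w | ((expR (l ^+ 2 * N%:R))%:E <= `|(EFin \o Z) w|)%E] =
    [set w | expR (l ^+ 2 * N%:R) <= Z w].
  by apply/seteqP; split=> w /=; rewrite lee_fin ger0_norm// ZE expR_ge0.
have -> : (\int[P]_w `|(EFin \o Z) w| = \int[P]_w (Z w)%:E)%E.
  by apply: eq_integral => w _ /=; rewrite ger0_norm// ZE expR_ge0.
move=> /le_trans/(_ intZ).
rewrite -lee_pdivlMl// => /le_trans; apply.
by rewrite -EFinM lee_fin -expRN -expRD ler_expR; lra.
Qed.

End Concentration.

(** * Splitting the horizon into blocks, mandatory rounds and residual rounds *)

Section Rounds.
Variables (R : realType) (K B : nat) (H : 'I_B -> nat).
Implicit Types (a : nat -> 'I_K) (n : 'I_B -> 'I_K -> nat) (i : 'I_K) (b : 'I_B).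

Lemma count_iota0S (p : pred nat) tau :
  count p (index_iota 0 tau.+1) = (count p (index_iota 0 tau) + p tau)%N.
Proof. by rewrite /index_iota !subn0 -addn1 iotaD count_cat /= add0n addn0. Qed.

Lemma pulls_cat a i r1 r2 r3 : (r1 <= r2)%N -> (r2 <= r3)%N ->
  pulls a i r1 r3 = (pulls a i r1 r2 + pulls a i r2 r3)%N.
Proof.
move=> r12 r23; rewrite /pulls /index_iota -count_cat; congr count.
have -> : (r3 - r1 = (r2 - r1) + (r3 - r2))%N by lia.
by rewrite iotaD subnKC.
Qed.

Lemma sum_pulls (F : 'I_K -> R) a r1 r2 :
  \sum_(r1 <= tau < r2) F (a tau) = \sum_i (pulls a i r1 r2)%:R * F i.
Proof.
rewrite /pulls; elim: (index_iota r1 r2) => [|tau s IH].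
  by rewrite big_nil big1// => i _; rewrite mul0r.
rewrite big_cons IH /= [RHS](eq_bigr (fun i => (a tau == i)%:R * F i +
  (count (fun tau => a tau == i) s)%:R * F i)); last by move=> i _; rewrite natrD mulrDl.
rewrite big_split /=; congr (_ + _).
rewrite (bigD1 (a tau))//= eqxx mul1r big1 ?addr0// => i.
by rewrite eq_sym => /negbTE ->; rewrite mul0r.
Qed.

Lemma big_ord_ltS (T : Type) (idx : T) (op : Monoid.com_law idx)
    (F : 'I_B -> T) k (kB : (k < B)%N) :
  \big[op/idx]_(c < B | (c < k.+1)%N) F c =
  op (\big[op/idx]_(c < B | (c < k)%N) F c) (F (Ordinal kB)).
Proof.
rewrite (bigD1 (Ordinal kB))/=; last by rewrite ltnS.
rewrite Monoid.mulmC; congr (op _ _); apply: eq_bigl => c.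
by rewrite ltnS -val_eqE /= [RHS]ltn_neqAle andbC.
Qed.

(** Extends [block_start] to the index [B], where it reaches the horizon. *)
Let cumul k : nat := \sum_(c < B | (c < k)%N) H c.

Let cumulS b : cumul b.+1 = block_end H b.
Proof.
rewrite /block_end /block_start /cumul (@big_ord_ltS _ _ _ _ _ (ltn_ord b)).
by congr (_ + H _)%N; exact: val_inj.
Qed.

Let cumul_horizon : cumul B = horizon H.
Proof. by apply: eq_bigl => c; rewrite ltn_ord. Qed.

Let cumul_le k l : (k <= l)%N -> (cumul k <= cumul l)%N.
Proof.
move=> kl; rewrite /cumul [leqRHS]big_mkcond [leqLHS]big_mkcond.
by apply: leq_sum => c _; case: ifP => // /leq_trans/(_ kl) ->.
Qed.

Lemma block_end_start (b c : 'I_B) : (b < c)%N -> (block_end H b <= block_start H c)%N.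
Proof. by rewrite -cumulS; exact: cumul_le. Qed.

(** Stated for a general monoid, to serve regret sums and round counts alike. *)
Lemma big_blocks (T : Type) (idx : T) (op : Monoid.com_law idx) (F : nat -> T) :
  \big[op/idx]_(0 <= tau < horizon H) F tau =
  \big[op/idx]_b \big[op/idx]_(block_start H b <= tau < block_end H b) F tau.
Proof.
suff H1 k : (k <= B)%N -> \big[op/idx]_(0 <= tau < cumul k) F tau =
    \big[op/idx]_(b < B | (b < k)%N)
      \big[op/idx]_(block_start H b <= tau < block_end H b) F tau.
  by rewrite -cumul_horizon H1//; apply: eq_bigl => b; rewrite ltn_ord.
elim: k => [|k IH] kB.
  have -> : cumul 0 = 0%N by rewrite /cumul big_pred0.
  by rewrite big_geq// big_pred0.
rewrite big_ord_ltS -IH; last exact: ltnW.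
have := cumulS (Ordinal kB) => /= e.
rewrite (@big_cat_nat _ _ _ (cumul k))//; last exact: cumul_le.
by rewrite e.
Qed.

(** Names no block, so that all residual rounds form one sum along which pull counts accumulate
    across blocks. *)
Definition residual_round n (tau : nat) : bool :=
  [exists b : 'I_B, (mandatory_end H n b <= tau < block_end H b)%N].

Lemma residual_round_block n b tau :
  (block_start H b <= tau < block_end H b)%N ->
  residual_round n tau = (mandatory_end H n b <= tau)%N.
Proof.
case/andP => bt te; apply/existsP/idP => [[c /andP[ct tc]]|mt]; last first.
  by exists b; rewrite mt.
suff -> : b = c by [].
have ct' : (block_start H c <= tau)%N by apply: leq_trans ct; exact: leq_addr.
have [bc|cb|/val_inj//] := ltngtP b c.
- have := block_end_start bc; lia.
- have := block_end_start cb; lia.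
Qed.

Lemma big_residual (T : Type) (idx : T) (op : Monoid.com_law idx) n (F : nat -> T) :
  (forall b, \sum_i n b i <= H b)%N ->
  \big[op/idx]_(0 <= tau < horizon H | residual_round n tau) F tau =
  \big[op/idx]_b \big[op/idx]_(mandatory_end H n b <= tau < block_end H b) F tau.
Proof.
move=> nH; rewrite big_mkcond big_blocks; apply: eq_bigr => b _.
have sm : (block_start H b <= mandatory_end H n b)%N by exact: leq_addr.
have me : (mandatory_end H n b <= block_end H b)%N by rewrite leq_add2l.
rewrite (big_cat_nat sm me) /= [X in op X _]big_nat_cond [X in op X _]big1.
  rewrite Monoid.mul1m; apply: eq_big_nat => tau /andP[mt te].
  by rewrite (@residual_round_block n b) ?mt// (leq_trans sm mt).
move=> tau; rewrite andbT => /andP[st tm].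
rewrite (@residual_round_block n b) ?st ?(leq_trans tm me)//.
by rewrite leqNgt tm.
Qed.

(** The mandatory pulls earn the same total in the comparator and in the algorithm and cancel; only
    residual gaps remain. *)
Lemma fair_regretE (mu : 'I_K -> R) n a : (forall b, \sum_i n b i <= H b)%N ->
  (forall b i, pulls a i (block_start H b) (mandatory_end H n b) = n b i) ->
  fair_regret H mu n a =
  \sum_(0 <= tau < horizon H | residual_round n tau) (best_mean mu - mu (a tau)).
Proof.
move=> nH na; rewrite /fair_regret big_residual// big_blocks -sumrB.
apply: eq_bigr => b _.
have sm : (block_start H b <= mandatory_end H n b)%N by exact: leq_addr.
have me : (mandatory_end H n b <= block_end H b)%N by rewrite leq_add2l.
have e : \sum_(block_start H b <= tau < mandatory_end H n b) mu (a tau) =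
    \sum_i (n b i)%:R * mu i.
  by rewrite sum_pulls; apply: eq_bigr => i _; rewrite na.
rewrite (big_cat_nat sm me) /= e sumrB sumr_const_nat.
have -> : (block_end H b - mandatory_end H n b)%N = residual H n b.
  by rewrite subnDl.
by rewrite mulr_natl; ring.
Qed.

Lemma sum_residual n : (forall b, \sum_i n b i <= H b)%N ->
  count (residual_round n) (index_iota 0 (horizon H)) = (\sum_b residual H n b)%N.
Proof.
move=> nH; rewrite -sum1_count big_residual//; apply: eq_bigr => b _.
by rewrite sum_nat_const_nat muln1 subnDl.
Qed.

End Rounds.

(** * Pathwise summation of the gaps by a potential *)

Section Potential.
Variables (R : realType) (K : nat) (a : nat -> 'I_K) (res : pred nat).

(** With u and v the two roots on the right, 1 = (u - v)(u + v) <= 2u(u - v). The slack [j <= k]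
    lets [j] follow the residual pulls while the confidence width depends on all pulls. *)
Lemma sqrt_nat_increment (j k : nat) : (j <= k)%N ->
  (Num.sqrt k.+1%:R)^-1 <= 2 * (Num.sqrt j.+1%:R - Num.sqrt j%:R) :> R.
Proof.
move=> jk; set u := Num.sqrt j.+1%:R; set v := Num.sqrt j%:R.
have u0 : 0 < u by rewrite sqrtr_gt0 ltr0n.
have v0 : 0 <= v by exact: sqrtr_ge0.
have uv : u ^+ 2 = v ^+ 2 + 1 by rewrite !sqr_sqrtr ?ler0n// natr1.
have vu : v <= u by rewrite ler_wsqrtr// ler_nat.
apply: (@le_trans _ _ u^-1).
  by rewrite lef_pV2 ?posrE ?sqrtr_gt0 ?ltr0n// ler_wsqrtr// ler_nat.
rewrite -(ler_pM2r u0) mulVf ?gt_eqF//; nra.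
Qed.

(** Cauchy-Schwarz in its variance form: the squared distances of the roots to their average
    [S / K%:R] have a nonnegative sum. *)
Lemma sum_sqrt_nat_le (m : 'I_K -> nat) :
  \sum_i Num.sqrt (m i)%:R <= Num.sqrt (K%:R * (\sum_i m i)%N%:R) :> R.
Proof.
set S := \sum_i _; set M := (\sum_i m i)%N.
have S0 : 0 <= S by apply: sumr_ge0 => i _; exact: sqrtr_ge0.
have [K0|K0] := posnP K.
  by rewrite /S big1 ?sqrtr_ge0// => -[i iK]; exfalso; rewrite K0 in iK.
suff : S ^+ 2 <= K%:R * M%:R.
  by move=> h; rewrite -(ger0_norm S0) -sqrtr_sqr ler_wsqrtr.
have K0' : 0 < K%:R :> R by rewrite ltr0n.
have : 0 <= \sum_(i < K) (Num.sqrt (m i)%:R - S / K%:R) ^+ 2.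
  by apply: sumr_ge0 => i _; exact: sqr_ge0.
rewrite (eq_bigr (fun i => (m i)%:R - 2 * (S / K%:R) * Num.sqrt (m i)%:R + (S / K%:R) ^+ 2)); last first.
  by move=> i _; rewrite sqrrB sqr_sqrtr ?ler0n//; ring.
rewrite big_split sumrB /= -mulr_sumr -/S -natr_sum -/M sumr_const card_ord.
have -> : M%:R - 2 * (S / K%:R) * S + (S / K%:R) ^+ 2 *+ K =
  (K%:R * M%:R - S ^+ 2) / K%:R by rewrite -mulr_natr; field; rewrite gt_eqF.
by rewrite pmulr_lge0 ?invr_gt0// subr_ge0.
Qed.

(* Potential of an arm pulled N times, M of them in residual rounds. The first
   pull pays 1; the minimum with N - 1 accounts for a first pull that may be
   mandatory or residual. *)
Let phi (c : R) (N M : nat) : R := (0 < N)%N%:R + 2 * c * Num.sqrt (minn M N.-1)%:R.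

(** Every residual gap is paid by the growth of [phi] at the pulled arm; a mandatory pull never
    lowers [phi], and the other arms do not change. *)
Lemma sum_gap_le (c : R) (g : nat -> R) (T : nat) : 0 <= c ->
  (forall tau, (tau < T)%N -> res tau ->
     g tau <= if pulls a (a tau) 0 tau == 0%N then 1
              else c / Num.sqrt (pulls a (a tau) 0 tau)%:R) ->
  \sum_(0 <= tau < T | res tau) g tau <=
  K%:R + 2 * c * Num.sqrt (K%:R * (count res (index_iota 0 T))%:R).
Proof.
move=> c0 hg.
pose N i tau := pulls a i 0 tau.
pose M i tau := count (fun s => res s && (a s == i)) (index_iota 0 tau).
have NS i tau : N i tau.+1 = (N i tau + (a tau == i))%N by exact: count_iota0S.
have MS i tau : M i tau.+1 = (M i tau + (res tau && (a tau == i)))%N.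
  exact: count_iota0S.
have step : forall tau, (tau <= T)%N ->
    \sum_(0 <= s < tau | res s) g s <= \sum_i phi c (N i tau) (M i tau).
  elim=> [_|tau IH tT].
    rewrite big_geq//; apply: sumr_ge0 => i _.
    by rewrite /phi addr_ge0 ?ler0n// mulr_ge0 ?sqrtr_ge0// mulr_ge0.
  rewrite big_mkcond big_nat_recr//= -big_mkcond.
  apply: (le_trans (lerD (IH (ltnW tT)) (lexx _))).
  rewrite (bigD1 (a tau))//= [leRHS](bigD1 (a tau))//= NS MS eqxx andbT.
  rewrite [X in _ <= _ + X](eq_bigr (fun i => phi c (N i tau) (M i tau))); last first.
    by move=> i; rewrite NS MS eq_sym => /negbTE ->; rewrite andbF !addn0.
  rewrite addrAC lerD2r.
  have := hg tau tT; rewrite -/(N (a tau) tau).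
  move: (N (a tau) tau) (M (a tau) tau) => x y.
  rewrite addn1; case: (res tau) => [/(_ isT) h|_]; last first.
    rewrite addr0 addn0 /phi /= lerD//.
      by rewrite ler_nat; case: x.
    rewrite ler_wpM2l ?mulr_ge0// ler_wsqrtr// ler_nat; lia.
  (* A residual first pull raises [phi] by exactly 1. After [x.+1] pulls the minimum grows from
     [minn y x] to its successor, and [minn y x <= x] makes this growth pay for c / sqrt (x + 1). *)
  rewrite addn1; case: x h => [|x] /= h.
    by rewrite /phi /= !minn0 sqrtr0 mulr0 !addr0 add0r.
  rewrite /phi /= minnSS -addrA lerD2l.
  have := sqrt_nat_increment (geq_minr y x).
  move: h; set u := _^-1; set v := Num.sqrt _; set z := Num.sqrt _ => h1 h2.
  have := ler_wpM2l c0 h2; lra.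
apply: le_trans (step T (leqnn T)) _; rewrite big_split /= lerD//.
  apply: (@le_trans _ _ (\sum_(i < K) 1)); last by rewrite sumr_const card_ord.
  by apply: ler_sum => i _; case: (N i T).
rewrite -mulr_sumr ler_wpM2l ?mulr_ge0//.
have -> : count res (index_iota 0 T) = (\sum_i M i T)%N.
  rewrite /M; elim: (index_iota 0 T) => [|s r IH] /=; first by rewrite big1.
  rewrite big_split /= -IH; congr addn.
  rewrite (bigD1 (a s))//= eqxx andbT big1 ?addn0// => i.
  by rewrite eq_sym => /negbTE ->; rewrite andbF.
apply: le_trans (sum_sqrt_nat_le _); apply: ler_sum => i _.
by rewrite ler_wsqrtr// ler_nat geq_minl.
Qed.

End Potential.

(** * Optimism of the index when the empirical means are accurate *)

Section UCB.
Variables (R : realType) (K : nat).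
Variables (L : R) (mu : 'I_K -> R) (X : 'I_K -> nat -> R) (a : nat -> 'I_K).

(** Rewards are indexed by arm and pull number, so an adaptively sampled arm still shows an initial
    segment of a fixed sequence. *)
Lemma sum_reward i tau :
  \sum_(0 <= s < tau | a s == i) reward X a s = \sum_(0 <= k < pulls a i 0 tau) X i k.
Proof.
elim: tau => [|tau IH]; first by rewrite !big_geq.
rewrite big_mkcond big_nat_recr//= -big_mkcond IH.
have -> : pulls a i 0 tau.+1 = (pulls a i 0 tau + (a tau == i))%N by exact: count_iota0S.
case: eqP => [<-|_]; last by rewrite addr0 addn0.
by rewrite addn1 big_nat_recr.
Qed.

(** Concerns the fixed reward sequences and not the run [a]: a union bound over arms and lengths
    then covers every adaptive choice. Lengths run over 1, ..., [T], hence [k.+1]. *)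
Definition good_means (T : nat) : Prop := forall i k, (k < T)%N ->
  `|\sum_(0 <= j < k.+1) (X i j - mu i)| <= k.+1%:R * Num.sqrt (2 * L / k.+1%:R).

Lemma good_empirical_mean T i tau : good_means T -> (tau <= T)%N ->
  pulls a i 0 tau != 0%N ->
  `|empirical_mean X a i tau - mu i| <= Num.sqrt (2 * L / (pulls a i 0 tau)%:R).
Proof.
move=> good tT; rewrite /empirical_mean sum_reward.
have : (pulls a i 0 tau <= tau)%N.
  by apply: leq_trans (count_size _ _) _; rewrite size_iota subn0.
case: (pulls a i 0 tau) => [//|k] kt _.
have k0 : 0 < k.+1%:R :> R by rewrite ltr0n.
have := good i k (leq_trans kt tT).
rewrite sumrB sumr_const_nat subn0 -[mu i *+ _]mulr_natl => h.
rewrite -(ler_pM2l k0); apply: le_trans _ h.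
rewrite -[X in X * _](ger0_norm (ltW k0)) -normrM mulrBr mulrCA divff ?mulr1//.
Qed.

(** Optimism: the mean of an observed arm is at most its index, hence at most the index of the
    pulled arm, which exceeds that arm's mean by at most two widths. *)
Lemma ucb_gap T tau : good_means T -> (tau < T)%N ->
  (forall i, 0 <= mu i <= 1) ->
  (forall j, ucb_index L X a j tau <= ucb_index L X a (a tau) tau)%E ->
  best_mean mu - mu (a tau) <=
    if pulls a (a tau) 0 tau == 0%N then 1
    else 2 * Num.sqrt (2 * L) / Num.sqrt (pulls a (a tau) 0 tau)%:R.
Proof.
move=> good tT mu01 ucb; have [mua0 _] := andP (mu01 (a tau)).
case: eqP => [_|/eqP N0].
  rewrite lerBlDr; apply: bigmax_le; first by rewrite addr_ge0.
  by move=> i _; have /andP[_ h] := mu01 i; apply: (le_trans h); rewrite lerDl.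
set N := pulls _ _ _ _ in N0 *.
have sqE M : Num.sqrt (2 * L / M%:R) = Num.sqrt (2 * L) / Num.sqrt M%:R.
  by rewrite mulrC sqrtrM ?invr_ge0// sqrtrV// mulrC.
rewrite lerBlDr -mulrA -sqE; apply: bigmax_le.
  by rewrite addr_ge0// mulr_ge0// sqrtr_ge0.
move=> i _; move: (ucb i); rewrite /ucb_index (negbTE N0).
(* An unobserved arm has index [+oo] and could not lie below the finite index of the pulled arm. *)
case: ifPn => [//|Ni0]; rewrite lee_fin => ucbi.
have := @good_empirical_mean T i tau good (ltnW tT) Ni0.
have := @good_empirical_mean T (a tau) tau good (ltnW tT) N0.
rewrite -/N !ler_norml => /andP[_ h1] /andP[h2 _].
lra.
Qed.

End UCB.

(** * Probability of the concentration event *)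

Section GoodEvent.
Context (d : measure_display) (Omega : measurableType d) (R : realType).
Variable P : probability Omega R.

Lemma measure_bigsetU_le (I : Type) (s : seq I) (F : I -> set Omega) :
  (forall i, measurable (F i)) ->
  (P (\big[setU/set0]_(i <- s) F i) <= \sum_(i <- s) P (F i))%E.
Proof.
move=> mF; elim: s => [|i s IH]; first by rewrite !big_nil measure0.
rewrite !big_cons; apply: le_trans (measureU2 _ _ _) _ => //.
  by apply: bigsetU_measurable.
by rewrite leeD2l.
Qed.

Variables (K : nat) (mu : 'I_K -> R) (X : 'I_K -> nat -> {RV P >-> R}).
Hypothesis rewards : bandit_rewards mu X.

Lemma reward_means_itv i : 0 <= mu i <= 1.
Proof.
exact: expectation_itv (rewards_bounded rewards i 0) (rewards_mean rewards i 0).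
Qed.

Definition deviation (L : R) (i : 'I_K) (k : nat) : set Omega :=
  [set w | k.+1%:R * Num.sqrt (2 * L / k.+1%:R) <
           `|\sum_(0 <= j < k.+1) (X i j w - mu i)|].

Let measurable_sumX i k :
  measurable_fun setT (fun w => \sum_(0 <= j < k) (X i j w - mu i)).
Proof.
apply: measurable_sum => j; apply: measurable_funB => //; exact: measurable_funP.
Qed.

Lemma measurable_deviation L i k : measurable (deviation L i k).
Proof.
have m : measurable_fun setT (fun w => `|\sum_(0 <= j < k.+1) (X i j w - mu i)|).
  exact: measurableT_comp (measurable_sumX i k.+1).
have := m measurableT _ (measurable_itv `]k.+1%:R * Num.sqrt (2 * L / k.+1%:R), +oo[).
rewrite setTI; congr measurable; apply/seteqP.
by split=> w /=; rewrite in_itv/= andbT.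
Qed.

(** The width e satisfies e^2 (k + 1) / 2 = L, the Chernoff exponent; the parameters [e] and [- e]
    cover the two tails, whence the factor 2. *)
Lemma deviation_le L i k : 0 < L ->
  (P (deviation L i k) <= (2 * expR (- L))%:E)%E.
Proof.
move=> L0; set e := Num.sqrt (2 * L / k.+1%:R).
have k0 : 0 < k.+1%:R :> R by rewrite ltr0n.
have e0 : 0 < e by rewrite sqrtr_gt0 divr_gt0// mulr_gt0.
have e2 : e ^+ 2 * k.+1%:R = 2 * L.
  by rewrite sqr_sqrtr ?divfK ?gt_eqF// divr_ge0 ?mulr_ge0 ?ltW.
(* The Chernoff bound requires [e <= 1]. For larger [e] the threshold exceeds k + 1, which bounds
   the absolute value of the centered sum, so the event is empty. *)
have [e1|e1] := leP e 1; last first.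
  rewrite (_ : deviation L i k = set0) ?measure0 ?lee_fin ?mulr_ge0 ?expR_ge0//.
  apply/seteqP; split=> w //=; rewrite /deviation /= -/e ltNge => /negP; apply.
  apply: (@le_trans _ _ k.+1%:R); last by rewrite ler_peMr ?ltW.
  apply: le_trans (ler_norm_sum _ _ _) _.
  apply: (@le_trans _ _ (\sum_(0 <= j < k.+1) 1)); last by rewrite sumr_const_nat subn0.
  apply: ler_sum => j _; rewrite ler_norml.
  have /andP[? ?] := rewards_bounded rewards i j w.
  have /andP[? ?] := reward_means_itv i.
  by apply/andP; split; lra.
pose s := [seq (i, j) | j <- index_iota 0 k.+1].
have us : uniq s by rewrite map_inj_uniq ?iota_uniq// => x y [].
have sums w : \sum_(p <- s) (X p.1 p.2 w - mu p.1) = \sum_(0 <= j < k.+1) (X i j w - mu i).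
  by rewrite big_map.
pose Aset l := [set w | l ^+ 2 * k.+1%:R <= l * \sum_(0 <= j < k.+1) (X i j w - mu i)].
have mA l : measurable (Aset l).
  have m : measurable_fun setT (fun w => l * \sum_(0 <= j < k.+1) (X i j w - mu i)).
    exact: measurable_funM.
  have := m measurableT _ (measurable_itv `[l ^+ 2 * k.+1%:R, +oo[).
  rewrite setTI; congr measurable; apply/seteqP.
  by split=> w /=; rewrite in_itv/= andbT.
have PA l : l ^+ 2 = e ^+ 2 -> (P (Aset l) <= (expR (- L))%:E)%E.
  move=> l2.
  have l1 : `|l| <= 1.
    by rewrite -(@ler_pXn2r _ 2)// ?nnegrE// expr1n real_normK ?num_real// l2 exprn_ile1// ltW.
  have := hoeffding_tail (rewards_indep rewards) us (fun p => rewards_bounded rewards p.1 p.2)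
    (fun p => rewards_mean rewards p.1 p.2) l1.
  rewrite size_map size_iota subn0 l2 e2.
  have -> : 2 * L / 2 = L by field.
  congr (P _ <= _)%E; apply/seteqP; split=> w; rewrite /Aset /= sums l2 e2//.
apply: (@le_trans _ _ (P (Aset e `|` Aset (- e)))).
  apply: le_measure; rewrite ?inE//; first exact: measurable_deviation.
    exact: measurableU.
  move=> w; rewrite /deviation /Aset /= -/e; set S := \sum_(0 <= _ < _) _ => h.
  rewrite sqrrN expr2 -mulrA mulNr -mulrN !ler_pM2l// [e * _]mulrC.
  by move: h; rewrite ltr_normr => /orP[]/ltW; auto.
apply: le_trans (measureU2 _ _ _) _ => //.
by rewrite mulrDl mul1r EFinD; apply: leeD; apply: PA; rewrite ?sqrrN.
Qed.

(** Union bound over the [K * T] deviation events. Positivity of [L] is asked only for [0 < T]: at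
    horizon 0 the logarithm is taken at 0, where its default value is 0. *)
Lemma good_means_probability (L : R) (T : nat) : ((0 < T)%N -> 0 < L) ->
  exists2 E, measurable E &
  (forall w, E w -> good_means L mu (fun i s => X i s w) T) /\
  (1 - (2 * K%:R * T%:R * expR (- L))%:E <= P E)%E.
Proof.
move=> L0.
pose bad := \big[setU/set0]_(p : 'I_K * 'I_T) deviation L p.1 p.2.
have mbad : measurable bad by apply: bigsetU_measurable => p _; exact: measurable_deviation.
exists (~` bad); first exact: measurableC.
split.
  move=> w /= nb i k kT; rewrite leNgt; apply/negP => h; apply: nb.
  by rewrite /bad -bigcup_seq; exists (i, Ordinal kT); rewrite //= mem_index_enum.
rewrite probability_setC// leeB//.
apply: le_trans (measure_bigsetU_le _ _) _ => [p|].
  exact: measurable_deviation.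
apply: (@le_trans _ _ (\sum_(p : 'I_K * 'I_T) (2 * expR (- L))%:E)%E).
  apply: lee_sum => p _; apply: deviation_le; apply: L0.
  exact: leq_ltn_trans (ltn_ord p.2).
rewrite sumEFin lee_fin sumr_const card_prod !card_ord -[leLHS]mulr_natr natrM.
lra.
Qed.

End GoodEvent.

(** * Measurability of the regret event and the final guarantee *)

(** The pulled arm takes finitely many values, so [mu (A w tau)] is a finite combination of
    indicators of measurable events. *)
Lemma measurable_fair_regret_le (d : measure_display) (Omega : measurableType d)
    (R : realType) (K B : nat) (H : 'I_B -> nat) (mu : 'I_K -> R)
    (n : 'I_B -> 'I_K -> nat) (A : Omega -> nat -> 'I_K) (c : R) :
  (forall tau i, (tau < horizon H)%N -> measurable [set w | A w tau = i]) ->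
  measurable [set w | fair_regret H mu n (A w) <= c].
Proof.
move=> mA.
have m : measurable_fun setT (fun w => fair_regret H mu n (A w)).
  apply: measurable_funB => //.
  under eq_fun do rewrite big_mkord.
  apply: measurable_sum => tau.
  rewrite (_ : (fun w => _) = fun w => \sum_i mu i * \1_[set w | A w tau = i] w).
    apply: measurable_sum => i; apply: measurable_funM => //.
    exact/measurable_indic/mA.
  apply/funext => w; rewrite (bigD1 (A w tau))//= indicE mem_set// mulr1.
  rewrite big1 ?addr0// => i /eqP iA; rewrite indicE memNset ?mulr0//= => Ai.
  exact: iA.
have := m measurableT _ (measurable_itv `]-oo, c]).
by rewrite setTI; congr measurable; apply/seteqP; split=> w /=; rewrite in_itv.
Qed.

Unset Implicit Arguments.

Theorem corollary7
  (d : measure_display) (Omega : measurableType d) (R : realType)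
  (P : probability Omega R)
  (K B t : nat) (H : 'I_B -> nat)
  (mu : 'I_K -> R) (X : 'I_K -> nat -> {RV P >-> R})
  (G : {set {set 'I_K}}) (f : {set 'I_K} -> R)
  (x : 'I_B -> 'rV[R]_K) (n : 'I_B -> 'I_K -> nat)
  (A : Omega -> nat -> 'I_K) (eta : R)
  (K_gt0 : (0 < K)%N)
  (t_ge1 : (1 <= t)%N)
  (eta_in : 0 < eta < 1)
  (rewards : bandit_rewards mu X)
  (degree_le : forall i : 'I_K, (#|[set g in G | i \in g]%SET| <= t)%N)
  (plan_ge0 : forall b i, 0 <= x b 0 i)
  (plan_feasible : forall b g, g \in G -> f g + t%:R <= \sum_(i in g) x b 0 i)
  (ceiling_budget : forall b, \sum_i Num.ceil (x b 0 i) <= (H b)%:Z)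
  (rounding : forall b, beck_fiala_rounding t G (x b) (n b))
  (A_measurable : forall tau i, (tau < horizon H)%N ->
     measurable [set w | A w tau = i]) :
  let L : R := ln (2 * K%:R * (horizon H)%:R / eta) in
  let Rtot : nat := (\sum_b residual H n b)%N in
  (forall w, group_bdq_ucb H L n (fun i s => X i s w) (A w)) ->
  (forall w b g, g \in G -> f g <= (\sum_(i in g) block_pulls H (A w) b i)%:R)
  /\ ((1 - eta)%:E <=
      P [set w | (fair_regret H mu n (A w)
                 <= K%:R + 4 * Num.sqrt (2 * K%:R * Rtot%:R * L))%R])%E.
Proof.
move=> L Rtot alg.
have nH b : (\sum_i n b i <= H b)%N.
  exact: beck_fiala_budget (rounding b) (ceiling_budget b).
split.
  (* The slack [t] of the plan cancels the rounding loss [t]; residual pulls can only raise the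
     block counts. *)
  move=> w b g gG; have := beck_fiala_group (rounding b) gG.
  move=> /(le_trans (plan_feasible b g gG)); rewrite lerD2r => /le_trans; apply.
  rewrite -natr_sum ler_nat; apply: leq_sum => i _.
  rewrite -(mandatory_rounds (alg w) b i) /block_pulls.
  rewrite [leqRHS](@pulls_cat _ _ _ _ (mandatory_end H n b)) ?leq_addr//.
  by rewrite leq_add2l.
have mu01 i := reward_means_itv rewards i.
have regret w : good_means L mu (fun i s => X i s w) (horizon H) ->
    fair_regret H mu n (A w) <= K%:R + 4 * Num.sqrt (2 * K%:R * Rtot%:R * L).
  move=> good; rewrite fair_regretE//; last exact: mandatory_rounds (alg w).
  (* With this [c] the bound of [ucb_gap] reads c / sqrt N, and 2 c sqrt (K R) is the announced 4
     sqrt (2 K R L). *)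
  apply: le_trans (sum_gap_le (c := 2 * Num.sqrt (2 * L)) _ _) _.
  - by rewrite mulr_ge0// sqrtr_ge0.
  - move=> tau tT /existsP[b rb].
    by apply: ucb_gap good tT mu01 _; exact: residual_rounds (alg w) b tau rb.
  rewrite sum_residual// -/Rtot lerD2l.
  have -> : 2 * K%:R * Rtot%:R * L = K%:R * Rtot%:R * (2 * L) by ring.
  by rewrite [Num.sqrt (_ * (2 * L))]sqrtrM ?mulr_ge0// le_eqVlt; apply/orP; left; apply/eqP; ring.
have [eta0 eta1] := andP eta_in.
have KT : (0 < horizon H)%N -> 0 < 2 * K%:R * (horizon H)%:R :> R.
  by move=> T0; rewrite !mulr_gt0 ?ltr0n.
have L0 : (0 < horizon H)%N -> 0 < L.
  move=> T0; rewrite ln_gt0// ltr_pdivlMr// mul1r (lt_le_trans eta1)//.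
  by rewrite -!natrM ler1n !muln_gt0 K_gt0.
have [E mE [goodE PE]] := good_means_probability rewards L0.
apply: (@le_trans _ _ (P E)).
  apply: le_trans PE; rewrite EFinB leeB// lee_fin.
  (* At horizon 0 the failure bound is 0; otherwise e^(-L) = eta / (2KT) and it is exactly [eta]. *)
  have [T0|T0] := posnP (horizon H); first by rewrite T0 mulr0 mul0r ltW.
  rewrite expRN lnK ?posrE ?divr_gt0 ?KT// invf_div mulrCA divff ?mulr1//.
  by rewrite gt_eqF ?KT.
apply: le_measure; rewrite ?inE//.
  exact: measurable_fair_regret_le.
by move=> w /goodE; exact: regret.
Qed.
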